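(* Let $\Gamma$ be a finite group and let $f:\Gamma\to\mathbb{R}$ be a real-valued function. Define the kernel $\mathcal{C}_f:\Gamma\times\Gamma\to\mathbb{R}$ by $$\mathcal{C}_f(x,y):=\mathbb{E}_{z\in\Gamma}\, f(x^{-1}z)\,f(zy^{-1}).$$ Then for every finite directed graph $F$, $$t(F,\mathcal{C}_f)\;\geq\; t(\overrightarrow{K_2},\mathcal{C}_f)^{e(F)}.$$ Equivalently (since $t(\overrightarrow{K_2},\mathcal{C}_f)=\left(\mathbb{E}_{g\in\Gamma}f(g)\right)^2$), for every finite directed graph $F$, $$t(F,\mathcal{C}_f)\;\geq\;\left(\mathbb{E}_{g\in\Gamma}f(g)\right)^{2e(F)}.$$
   Context: For a finite set $S$, $\mathbb{E}_{s\in S}$ denotes the uniform average $\frac{1}{|S|}\sum_{s\in S}$. For a finite directed graph $F$ with vertex set $V(F)$ and directed edge set $E(F)$, write $e(F)=|E(F)|$, and for $e\in E(F)$ write $e^-$ for the tail and $e^+$ for the head of $e$ (so $e$ is directed from $e^-$ to $e^+$). For a kernel $W:\Gamma\times\Gamma\to\mathbb{R}$ on a finite group $\Gamma$ (equipped with the uniform probability measure), the directed homomorphism density is $$t(F,W):=\mathbb{E}_{x:V(F)\to\Gamma}\ \prod_{e\in E(F)}W(x_{e^-},x_{e^+}),$$ the average being over all maps $x:V(F)\to\Gamma$. $\overrightarrow{K_2}$ is the directed graph on two vertices consisting of one directed edge, so $t(\overrightarrow{K_2},W)=\mathbb{E}_{x,y\in\Gamma}W(x,y)$. Empty products and zeroth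 powers equal $1$. *)

(* Defs.v *)
From HB Require Import structures.
From mathcomp Require Import all_boot all_order all_algebra all_fingroup.
From mathcomp Require Import reals.

Set Implicit Arguments.
Unset Strict Implicit.
Unset Printing Implicit Defensive.

Import Order.TTheory GRing.Theory Num.Theory.
Local Open Scope ring_scope.

(* Edges form a type of their own, so loops, antiparallel edges and parallel
   edges are all allowed; a digraph given by a set E of ordered pairs of
   vertices is the case where the edges are {e | e \in E} and the tail and
   head maps are the two projections. *)
Record digraph := Digraph {
  vertex : finType;
  edge : finType;
  tail : edge -> vertex;
  head : edge -> vertex
}.

Definition num_edges (F : digraph) : nat := #|edge F|.

Definition dirK2 : digraph :=
  @Digraph 'I_2 unit (fun=> ord0) (fun=> ord_max).

Definition avg (R : realType) (S : finType) (h : S -> R) : R :=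
  #|S|%:R^-1 * \sum_(s : S) h s.

Definition hom_density (R : realType) (T : finType) (F : digraph)
    (W : T -> T -> R) : R :=
  avg (fun x : {ffun vertex F -> T} =>
    \prod_(e : edge F) W (x (tail e)) (x (head e))).

Definition conv_kernel (R : realType) (gT : finGroupType) (f : gT -> R)
    (x y : gT) : R :=
  avg (fun z : gT => f (x^-1 * z)%g * f (z * y^-1)%g).

(* Main.v *)
Require Import Defs.
From mathcomp Require Import all_boot all_order all_algebra all_fingroup.
From mathcomp Require Import reals.

Set Implicit Arguments.
Unset Strict Implicit.
Unset Printing Implicit Defensive.

Import Order.TTheory GRing.Theory Num.Theory.
Local Open Scope ring_scope.

(** Substituting [g = z y^-1] in the definition of the kernel gives
    [C_f(x, y) = E_g f(g) f(x^-1 g y)], a matrix coefficient of the two-sided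
    translation action of [gT * gT] on functions on [gT].  Multiply this over
    the edges of [F] and let [G] be the tensor power [g |-> \prod_e f (g e)] of
    [f], a function on edge labellings.  The product is the correlation of [G]
    with its translate by [x], for the action of the group [gT ^ V(F)] on
    [gT ^ E(F)] in which [x] sends the label [g e] to
    [(x (tail e))^-1 * g e * x (head e)].  Averaging over [x] projects [G]
    orthogonally onto the invariant functions, so [t(F, C_f)] is the squared
    norm of that projection ([avg_correlation_act]).  Constants are invariant,
    hence by Cauchy-Schwarz this is at least the square of the mean of [G]
    ([avg_correlation_ge]), and the mean of a tensor power is
    [(E f) ^ e(F)] ([avg_prod_ffun]). *)

Lemma eq_avg (R : realType) (S : finType) (h k : S -> R) :
  h =1 k -> avg h = avg k.
Proof. by move=> hk; congr (_ * _); apply: eq_bigr. Qed.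

Lemma avg_const (R : realType) (S : finType) (c : R) :
  (0 < #|S|)%N -> avg (fun _ : S => c) = c.
Proof.
move=> S_gt0; rewrite /avg sumr_const -[c *+ _]mulr_natl mulKf //.
by rewrite pnatr_eq0 -lt0n.
Qed.

Lemma avg_const_group (R : realType) (gT : finGroupType) (c : R) :
  avg (fun _ : gT => c) = c.
Proof. by apply: avg_const; apply/card_gt0P; exists 1%g. Qed.

Lemma avgZ (R : realType) (S : finType) (c : R) (h : S -> R) :
  avg (fun s => c * h s) = c * avg h.
Proof. by rewrite /avg -mulr_sumr mulrCA. Qed.

Lemma avg_swap (R : realType) (S T : finType) (h : S -> T -> R) :
  avg (fun s => avg (h s)) = avg (fun t => avg (h^~ t)).
Proof. by rewrite /avg -!mulr_sumr exchange_big mulrCA. Qed.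

Lemma avg_reindex (R : realType) (S : finType) (p : S -> S) (h : S -> R) :
  injective p -> avg h = avg (fun s => h (p s)).
Proof. by move=> p_inj; rewrite /avg (reindex_inj p_inj). Qed.

(** Jensen's inequality for the square, which is Cauchy-Schwarz against the
    constant function 1. *)
Lemma avg_sqr_le (R : realType) (S : finType) (h : S -> R) :
  avg h ^+ 2 <= avg (fun s => h s ^+ 2).
Proof.
have [S0 | S_gt0] := posnP #|S|.
  by rewrite /avg S0 invr0 !mul0r expr0n.
have cS : 0 <= #|S|%:R^-1 :> R by rewrite invr_ge0.
(* The difference of the two sides is the variance of [h]. *)
rewrite -subr_ge0; suff ->: avg (fun s => h s ^+ 2) - avg h ^+ 2
    = avg (fun s => (h s - avg h) ^+ 2).
  by apply: mulr_ge0 => //; apply: sumr_ge0 => s _; apply: sqr_ge0.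
set m := avg h.
have -> : avg (fun s => (h s - m) ^+ 2)
    = avg (fun s => h s ^+ 2) + avg (fun s => - (m *+ 2) * h s)
      + avg (fun _ : S => m ^+ 2).
  rewrite /avg -!mulrDr -!big_split; congr (_ * _); apply: eq_bigr => s _ /=.
  by rewrite sqrrB mulNr mulrnAl [m * _]mulrC.
by rewrite avgZ avg_const // -/m mulNr mulrnAl -expr2 mulr2n opprD addrA subrK.
Qed.

(** Distributing the product over the sums turns independent averages, one for
    each index, into an average over all choice functions. *)
Lemma avg_prod_ffun (R : realType) (I S : finType) (h : I -> S -> R) :
  avg (fun x : {ffun I -> S} => \prod_i h i (x i)) = \prod_i avg (h i).
Proof.
by rewrite /avg big_split /= prodr_const exprVn -natrX -card_ffun
           bigA_distr_bigA.
Qed.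

(** The operator [A] that averages over the group is a self-adjoint idempotent,
    so [<G, A G> = <A G, A G>].  Concretely, translating by [b] preserves the
    average over [S] and fixes [A G], so [G s] may be replaced by
    [G (to s b)], and then by its average over [b], which is [A G s]. *)
Lemma avg_correlation_act (R : realType) (aT : finGroupType) (S : finType)
    (to : {action aT &-> S}) (G : S -> R) :
  avg (fun a => avg (fun s => G s * G (to s a)))
  = avg (fun s => avg (fun a => G (to s a)) ^+ 2).
Proof.
transitivity (avg (fun b : aT => avg (fun s => G (to s b) *
    avg (fun a => G (to s a))))).
  rewrite avg_swap.
  transitivity (avg (fun s => G s * avg (fun a => G (to s a)))).
    by apply: eq_avg => s; rewrite -avgZ.
  (* The left side does not depend on [b]: read it as an average over [b]. *)
  rewrite -[LHS](@avg_const_group R aT); apply: eq_avg => b.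
  rewrite (avg_reindex _ (act_inj to b)); apply: eq_avg => s; congr (_ * _).
  rewrite [RHS](avg_reindex _ (mulgI b)).
  by apply: eq_avg => a; rewrite actM.
rewrite avg_swap; apply: eq_avg => s.
by under eq_avg do rewrite mulrC; rewrite avgZ expr2.
Qed.

(** The group average of [G] has the same mean as [G], and the mean square of a
    function is at least the square of its mean. *)
Lemma avg_correlation_ge (R : realType) (aT : finGroupType) (S : finType)
    (to : {action aT &-> S}) (G : S -> R) :
  avg G ^+ 2 <= avg (fun a => avg (fun s => G s * G (to s a))).
Proof.
rewrite avg_correlation_act; apply: le_trans (avg_sqr_le _).
rewrite avg_swap.
suff -> : avg (fun a => avg (fun s => G (to s a))) = avg G by [].
transitivity (avg (fun _ : aT => avg G)); last exact: avg_const_group.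
by apply: eq_avg => a; rewrite [RHS](avg_reindex _ (act_inj to a)).
Qed.

(** Vertex labellings are typed as [{dffun ...}] because it is this form that
    carries the finite group structure of a direct power; it is convertible to
    [{ffun vertex F -> gT}], the index type of [hom_density].  The inverse sits
    at the tail so that this is a right action. *)
Definition gauge (gT : finGroupType) (F : digraph) (g : {ffun edge F -> gT})
    (x : {dffun forall _ : vertex F, gT}) : {ffun edge F -> gT} :=
  [ffun e => ((x (tail e))^-1 * g e * x (Defs.head e))%g].

Lemma gauge_is_action (gT : finGroupType) (F : digraph) :
  is_action [set: {dffun forall _ : vertex F, gT}] (@gauge gT F).
Proof.
apply: is_total_action => [g | g x y]; apply/ffunP => e.
  by rewrite !ffunE invg1 mul1g mulg1.
by rewrite !ffunE invMg !mulgA.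
Qed.

(** The substitution [z = g * y] exhibits the kernel as the correlation of [f]
    with a two-sided translate of itself. *)
Lemma conv_kernel_coeff (R : realType) (gT : finGroupType) (f : gT -> R) x y :
  conv_kernel f x y = avg (fun g => f g * f (x^-1 * g * y)%g).
Proof.
rewrite /conv_kernel (avg_reindex _ (mulIg y)); apply: eq_avg => g.
by rewrite mulgK mulrC mulgA.
Qed.

(** Expanding the product over edges into one average over edge labellings
    gives exactly the average correlation of the tensor power of [f] with its
    translates under the gauge action. *)
Lemma hom_density_conv_ge (R : realType) (gT : finGroupType) (f : gT -> R)
    (F : digraph) :
  avg f ^+ (2 * num_edges F) <= hom_density F (conv_kernel f).
Proof.
pose G (g : {ffun edge F -> gT}) := \prod_e f (g e).
have -> : hom_density F (conv_kernel f)
  = avg (fun x => avg (fun g => G g * G (Action (gauge_is_action gT F) g x))).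
  apply: eq_avg => x; under eq_bigr do rewrite conv_kernel_coeff.
  rewrite -avg_prod_ffun; apply: eq_avg => g; rewrite -big_split /=.
  by apply: eq_bigr => e _; rewrite ffunE.
suff -> : avg f ^+ (2 * num_edges F) = avg G ^+ 2 by apply: avg_correlation_ge.
by rewrite (avg_prod_ffun (fun=> f)) prodr_const mulnC exprM.
Qed.

(** For fixed [z] the two endpoints of the edge are independent, and each of
    [x^-1 * z] and [z * y^-1] is uniform on the group. *)
Lemma hom_density_dirK2_conv (R : realType) (gT : finGroupType) (f : gT -> R) :
  hom_density dirK2 (conv_kernel f) = avg f ^+ 2.
Proof.
pose h (z : gT) (i : 'I_2) (a : gT) :=
  if i == ord0 then f (a^-1 * z)%g else f (z * a^-1)%g.
have avg_h z i : avg (h z i) = avg f.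
  rewrite /h; case: eqP => _; rewrite (avg_reindex _ (@invg_inj gT));
    under eq_avg do rewrite invgK.
    by rewrite -(avg_reindex f (mulIg z)).
  by rewrite -(avg_reindex f (mulgI z)).
transitivity (avg (fun x : {ffun 'I_2 -> gT} =>
    avg (fun z => \prod_i h z i (x i)))).
  apply: eq_avg => x; rewrite (big_pred1 tt) => [|[]//].
  apply: eq_avg => z; rewrite big_ord_recl big_ord1.
  by have -> : lift ord0 ord0 = ord_max :> 'I_2 by apply: val_inj.
rewrite avg_swap -[RHS](@avg_const_group R gT); apply: eq_avg => z.
rewrite avg_prod_ffun; under eq_bigr do rewrite avg_h.
by rewrite prodr_const card_ord.
Qed.

Theorem theorem1p1 (R : realType) (gT : finGroupType) (f : gT -> R) :
  (forall F : digraph,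
     hom_density F (conv_kernel f)
       >= hom_density dirK2 (conv_kernel f) ^+ num_edges F) /\
  hom_density dirK2 (conv_kernel f) = avg f ^+ 2 /\
  (forall F : digraph,
     hom_density F (conv_kernel f) >= avg f ^+ (2 * num_edges F)).
Proof.
split=> [F|]; first by rewrite hom_density_dirK2_conv -exprM hom_density_conv_ge.
by split=> [|F]; [apply: hom_density_dirK2_conv | apply: hom_density_conv_ge].
Qed.
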